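(* Let $d\ge 2$ and let $b\in C^1_\sharp(Y_d)^d$ be a vector field for which there exist a positive function $\sigma\in C^0_\sharp(Y_d)$ and functions $v_1,\dots,v_d\in C^2(\mathbb{R}^d)$ with $Y_d$-periodic gradients such that $$b\cdot\nabla v_1=1\ \text{ in }Y_d\qquad\text{and}\qquad \sigma b=\begin{cases}R_\perp\nabla v_2 & \text{if }d=2,\\ \nabla v_2\times\cdots\times\nabla v_d & \text{if }d\ge 3,\end{cases}\ \text{ in }Y_d.$$ Let $X$ be the flow defined by $X'(t,x)=b(X(t,x))$ for $t\in\mathbb{R}$, $X(0,x)=x\in\mathbb{R}^d$. Then there exists a vector $\xi\in\mathbb{R}^d$ such that $$\forall\,x\in\mathbb{R}^d,\quad \lim_{|t|\to\infty}\frac{X(t,x)}{t}=\xi=\frac{\langle\sigma b\rangle}{\langle\sigma\rangle}.$$ Moreover, if there exists a non-zero vector $\lambda\in\mathbb{R}^d$ such that $b\cdot\lambda=0$ in $Y_d$, and if either $d=2$ and $\sigma b$ is not constant, or $d=3$ and $\sigma b$ is not of the form $\lambda\times\nabla w$, then the flow $X$ is not ergodic.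
   Context: $Y_d:=[0,1)^d$; a function $f$ on $\mathbb{R}^d$ is $Y_d$-periodic if $f(x+\kappa)=f(x)$ for all $\kappa\in\mathbb{Z}^d$; $C^k_\sharp(Y_d)$ is the space of $Y_d$-periodic functions of class $C^k$ in $\mathbb{R}^d$; $\langle f\rangle$ is the average value of $f$ over $Y_d$. $R_\perp$ is the clockwise $90^\circ$ rotation matrix in $\mathbb{R}^{2\times2}$. For $\xi^2,\dots,\xi^d\in\mathbb{R}^d$, the cross product $\xi^2\times\cdots\times\xi^d\in\mathbb{R}^d$ is defined by $\xi^1\cdot(\xi^2\times\cdots\times\xi^d)=\det(\xi^1,\xi^2,\dots,\xi^d)$ for all $\xi^1\in\mathbb{R}^d$. In the form $\lambda\times\nabla w$, $w$ ranges over the functions in $C^1(\mathbb{R}^3)$ with $Y_3$-periodic gradient. Since $b$ is $Y_d$-periodic, $X$ induces a flow on the torus $\mathbb{R}^d/\mathbb{Z}^d$, for which the measure $\sigma(x)\,dx$ is invariant. The flow $X$ is ergodic if every $Y_d$-periodic measurable function $f$ that is invariant by the flow ($f(X(t,x))=f(x)$ for all $t\in\mathbb{R}$ and a.e. $x\in\mathbb{R}^d$) is constant a.e. *)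

(* Defs.v *)
From HB Require Import structures.
From mathcomp Require Import all_boot all_order all_algebra.
From mathcomp Require Import all_classical all_reals all_analysis.

Set Implicit Arguments.
Unset Strict Implicit.
Unset Printing Implicit Defensive.
Import Order.TTheory GRing.Theory Num.Theory.
Import numFieldNormedType.Exports.

Local Open Scope classical_set_scope.
Local Open Scope ring_scope.

(* The product sigma-algebra on row vectors, as the library does for tuples;
   over a realType it is the Borel sigma-algebra of R^n. *)
Definition measure_row_display : measure_display -> measure_display.
Proof. exact. Qed.

Section measurable_row.
Context {d} {T : sigmaRingType d}.
Variable n : nat.

Let coors : 'I_n -> 'rV[T]_n -> T := fun i x => x ord0 i.

Let row_set0 : g_sigma_preimage coors set0.
Proof. exact: sigma_algebra0. Qed.

Let row_setC A : g_sigma_preimage coors A -> g_sigma_preimage coors (~` A).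
Proof. exact: sigma_algebraC. Qed.

Let row_bigcup (F : _^nat) : (forall i, g_sigma_preimage coors (F i)) ->
  g_sigma_preimage coors (\bigcup_i (F i)).
Proof. exact: sigma_algebra_bigcup. Qed.

HB.instance Definition _ := @isMeasurable.Build (measure_row_display d)
  'rV[T]_n (g_sigma_preimage coors) row_set0 row_setC row_bigcup.

Lemma measurable_coord (i : 'I_n) :
  measurable_fun [set: 'rV[T]_n] (fun x : 'rV[T]_n => x ord0 i).
Proof.
move=> _ Y mY; rewrite setTI; apply: sub_sigma_algebra => /=.
rewrite -bigcup_seq/=; exists i => /=; first by rewrite mem_index_enum.
by exists Y => //; rewrite setTI.
Qed.

End measurable_row.

Lemma measurable_fun_rowP d1 d2 (T1 : measurableType d1)
    (T2 : measurableType d2) n (f : T1 -> 'rV[T2]_n) :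
  measurable_fun [set: T1] f <->
  forall i, measurable_fun [set: T1] (fun x => f x ord0 i).
Proof.
split=> [mf i|mf].
  exact: (measurableT_comp (@measurable_coord _ T2 n i) mf).
suff prefS : g_sigma_preimage (fun i x => f x ord0 i) `<=` @measurable _ T1.
  move=> _ A mA; apply: prefS.
  by rewrite (g_sigma_preimage_comp (fun i (x : 'rV[T2]_n) => x ord0 i)); exists A.
apply: smallest_sub; first exact: sigma_algebra_measurable.
rewrite -bigcup_seq; apply: bigcup_sub => i _ A [B mB <-].
exact: mf.
Qed.

Section lebesgue_row.
Context {R : realType}.

Definition cons_row n (p : R * 'rV[R]_n) : 'rV[R]_n.+1 :=
  \row_j oapp (p.2 ord0) p.1 (unlift ord0 j).

Lemma cons_row0 n (p : R * 'rV[R]_n) : cons_row p ord0 ord0 = p.1.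
Proof. by rewrite mxE unlift_none. Qed.

Lemma cons_rowS n (p : R * 'rV[R]_n) i :
  cons_row p ord0 (lift ord0 i) = p.2 ord0 i.
Proof. by rewrite mxE liftK. Qed.

Lemma measurable_cons_row n : measurable_fun setT (@cons_row n).
Proof.
apply/measurable_fun_rowP => i; case: (unliftP ord0 i) => [j|] ->.
  under eq_fun do rewrite cons_rowS.
  exact: (measurableT_comp (@measurable_coord _ _ _ j) measurable_snd).
under eq_fun do rewrite cons_row0.
exact: measurable_fst.
Qed.

Definition uncons_row n (x : 'rV[R]_n.+1) : R * 'rV[R]_n :=
  (x ord0 ord0, \row_i x ord0 (lift ord0 i)).

Lemma cons_rowK n : cancel (@cons_row n) (@uncons_row n).
Proof.
move=> [a y]; rewrite /uncons_row cons_row0; congr pair.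
by apply/rowP => i; rewrite mxE cons_rowS.
Qed.

Lemma measurable_uncons_row n : measurable_fun setT (@uncons_row n).
Proof.
apply/measurable_fun_pairP; split; first exact: measurable_coord.
apply/measurable_fun_rowP => i.
by under eq_fun do rewrite mxE; exact: measurable_coord.
Qed.

Section step.
Variables (n : nat) (mu : {sigma_finite_measure set 'rV[R]_n -> \bar R}).
Local Open Scope ereal_scope.

Definition lebesgue_row_step : set 'rV[R]_n.+1 -> \bar R :=
  pushforward (@lebesgue_measure R \x mu) (@cons_row n).

Let step0 : lebesgue_row_step set0 = 0.
Proof. by rewrite /lebesgue_row_step /pushforward preimage_set0 measure0. Qed.

Let step_ge0 A : 0 <= lebesgue_row_step A.
Proof. exact: (measure_ge0 (@lebesgue_measure R \x mu)). Qed.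

Let measurable_step A : measurable A -> measurable (@cons_row n @^-1` A).
Proof. by move=> mA; rewrite -[X in measurable X]setTI; exact: measurable_cons_row. Qed.

Let step_sigma_additive : semi_sigma_additive lebesgue_row_step.
Proof.
move=> F mF tF mUF; rewrite /lebesgue_row_step /pushforward preimage_bigcup.
apply: (@measure_semi_sigma_additive _ _ _ (@lebesgue_measure R \x mu)
  (fun i => @cons_row n @^-1` F i)).
- by move=> i; exact: measurable_step.
- apply/trivIsetP => /= i j _ _ ij; rewrite -preimage_setI.
  by move/trivIsetP : tF => /(_ _ _ _ _ ij) ->//; rewrite preimage_set0.
- by rewrite -preimage_bigcup; exact: measurable_step.
Qed.

HB.instance Definition _ := isMeasure.Build _ _ _
  lebesgue_row_step step0 step_ge0 step_sigma_additive.

Let step_sigma_finite : sigma_finite setT lebesgue_row_step.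
Proof.
have /sigma_finiteP[F [TF ndF Foo]] := sigma_finiteT (@lebesgue_measure R).
have /sigma_finiteP[G [TG ndG Goo]] := sigma_finiteT mu.
exists (fun k => @uncons_row n @^-1` (F k `*` G k)).
  apply/seteqP; split=> // x _.
  have [k _ Fk] : (\bigcup_k F k) (x ord0 ord0) by rewrite -TF.
  have [l _ Gl] : (\bigcup_k G k) (\row_i x ord0 (lift ord0 i)) by rewrite -TG.
  exists (maxn k l) => //; split => /=.
    by move: Fk; exact/subsetPset/ndF/leq_maxl.
  by move: Gl; exact/subsetPset/ndG/leq_maxr.
move=> k; have [mF Fk] := Foo k; have [mG Gk] := Goo k; split.
  rewrite -[X in measurable X]setTI; apply: measurable_uncons_row => //.
  exact: measurableX.
rewrite /lebesgue_row_step /pushforward -comp_preimage.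
rewrite (_ : _ \o _ = id); last by apply/funext => p; exact: cons_rowK.
by rewrite preimage_id product_measure1E// lte_mul_pinfty// ge0_fin_numE.
Qed.

HB.instance Definition _ := Measure_isSigmaFinite.Build _ _ _
  lebesgue_row_step step_sigma_finite.

End step.

Fixpoint lebesgue_row n : {sigma_finite_measure set 'rV[R]_n -> \bar R} :=
  match n with
  | 0 => \d_(0 : 'rV[R]_0)
  | m.+1 => lebesgue_row_step (lebesgue_row m)
  end.

Lemma lebesgue_row_box n (A : 'I_n -> set R) : (forall i, measurable (A i)) ->
  lebesgue_row n [set x : 'rV[R]_n | forall i, A i (x ord0 i)] =
  (\prod_(i < n) @lebesgue_measure R (A i))%E.
Proof.
elim: n A => [A _|n IHn A mA].
  rewrite big_ord0 (_ : [set _ | _] = setT) ?probability_setT//.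
    by rewrite /= diracT.
  by apply/seteqP; split=> // x _ [].
rewrite big_ord_recl -IHn//= /lebesgue_row_step /pushforward.
rewrite -(@product_measure1E _ _ _ _ _ (@lebesgue_measure R) (lebesgue_row n))//.
  congr (_ \x _)%E; apply/seteqP; split=> [[a y] /= Aay|[a y] /= [Aa Ay] i].
    split; first by have := Aay ord0; rewrite cons_row0.
    by move=> i; have := Aay (lift ord0 i); rewrite cons_rowS.
  by case: (unliftP ord0 i) => [j|] ->; rewrite ?cons_rowS ?cons_row0.
  exact: mA.
rewrite (_ : [set _ | _] =
    \bigcap_(i in [set: 'I_n]) (fun x : 'rV[R]_n => x ord0 i) @^-1` A (lift ord0 i)).
  apply: fin_bigcap_measurable => // i _.
  by rewrite -[X in measurable X]setTI; exact: measurable_coord.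
by apply/seteqP; split=> [x Ax i _|x Ax i]; [exact: Ax|exact: (Ax i I)].
Qed.

End lebesgue_row.

Section vector_fields.
Context {R : realType}.

Definition dotmul d (x y : 'rV[R]_d) : R := \sum_i x ord0 i * y ord0 i.

Definition unit_cell {d} : set 'rV[R]_d :=
  [set x | forall i, 0 <= x ord0 i < 1].

Definition Yperiodic d (V : Type) (f : 'rV[R]_d -> V) : Prop :=
  forall (x : 'rV[R]_d) (k : 'rV[int]_d), f (x + map_mx intr k) = f x.

Fixpoint Ck d (V : normedModType R) (k : nat) (f : 'rV[R]_d -> V) : Prop :=
  match k with
  | 0 => continuous f
  | k'.+1 => (forall x, differentiable f x) /\
             forall i : 'I_d, Ck k' (fun x => 'D_(delta_mx ord0 i) f x)
  end.

Definition grad d (f : 'rV[R]_d -> R) (x : 'rV[R]_d) : 'rV[R]_d :=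
  \row_i 'D_(delta_mx ord0 i) f x.

(* No division by the volume of the cell, which is 1 (lebesgue_unit_cell). *)
Definition average d (f : 'rV[R]_d -> R) : R :=
  \int[lebesgue_row d]_(x in unit_cell) f x.

Definition average_field d (F : 'rV[R]_d -> 'rV[R]_d) : 'rV[R]_d :=
  \row_i average (fun x => F x ord0 i).

Lemma lebesgue_unit_cell d : lebesgue_row d unit_cell = 1%E.
Proof.
have -> : unit_cell =
    [set x : 'rV[R]_d | forall i, (fun=> `[0, 1[%classic) i (x ord0 i)].
  by apply/seteqP; split=> x /= Yx i; have := Yx i; rewrite /= in_itv.
rewrite (@lebesgue_row_box _ _ (fun=> `[0, 1[%classic))// big1// => i _.
by rewrite lebesgue_measure_itv/= lte_fin ltr01 oppr0 adde0.
Qed.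

(* Component j is det(e_j, xi_2, ..., xi_d), that is, the defining identity
   dotmul_cross at the j-th vector of the canonical basis. *)
Definition cross n (xi : 'I_n -> 'rV[R]_n.+1) : 'rV[R]_n.+1 :=
  \row_j \det (\matrix_(i < n.+1) oapp xi (delta_mx ord0 j) (unlift ord0 i)).

Lemma dotmul_cross n (xi1 : 'rV[R]_n.+1) (xi : 'I_n -> 'rV[R]_n.+1) :
  dotmul xi1 (cross xi) =
  \det (\matrix_(i < n.+1) oapp xi xi1 (unlift ord0 i)).
Proof.
rewrite (expand_det_row _ ord0); apply: eq_bigr => j _.
rewrite !mxE unlift_none/= (expand_det_row _ ord0) (bigD1 j)//= big1 => [|k kj].
  rewrite addr0 !mxE unlift_none/= mxE !eqxx mul1r; congr (_ * _).
  rewrite /cofactor; congr (_ * \det _).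
  by apply/matrixP => p q; rewrite !mxE liftK.
by rewrite !mxE unlift_none/= mxE (negPf kj) andbF mul0r.
Qed.

(* Clockwise rotation: (x, y) is sent to (y, - x). *)
Definition Rperp : 'M[R]_2 := \matrix_(i < 2, j < 2) ((i < j)%N%:R - (j < i)%N%:R).

(* In dimension n + 2, the vector built from xi^2, ..., xi^(n+2). *)
Definition stream_vector n : ('I_n.+1 -> 'rV[R]_n.+2) -> 'rV[R]_n.+2 :=
  match n with
  | 0 => fun xi => (Rperp *m (xi ord0)^T)^T
  | _ => fun xi => cross xi
  end.

Definition is_flow d (b : 'rV[R]_d -> 'rV[R]_d) (X : R -> 'rV[R]_d -> 'rV[R]_d) :
    Prop :=
  forall x, X 0 x = x /\ forall t : R, is_derive t (1 : R) (X ^~ x) (b (X t x)).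

Definition ergodic d (X : R -> 'rV[R]_d -> 'rV[R]_d) : Prop :=
  forall f : 'rV[R]_d -> R,
    Yperiodic f -> measurable_fun setT f ->
    (forall t, \forall x \ae lebesgue_row d, f (X t x) = f x) ->
    exists c, \forall x \ae lebesgue_row d, f x = c.

End vector_fields.

(* Main.v *)
Require Import Defs.
From mathcomp Require Import all_boot all_order all_algebra.
From mathcomp Require Import all_classical all_reals all_analysis.
From mathcomp Require Import perm measurable_realfun ring.
Import Order.TTheory GRing.Theory Num.Theory.
Import numFieldNormedType.Exports.
Local Open Scope classical_set_scope.
Local Open Scope ring_scope.

(** Let [D] be the matrix whose rows are the gradients of the [v i]. The two
    hypotheses on [b] say together that [sigma] is the determinant of [D] and that
    [sigma *: b] is the first row of its cofactor matrix. Hence [b] is orthogonal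
    to the gradients of all [v i] but the first, and [v] rectifies the flow: along
    a trajectory the first coordinate of [v] grows like time and the others stay
    constant ([first_integral]).

    A function with periodic gradient is a linear function, given by its [slope],
    plus a periodic and therefore bounded [fluctuation]. So the product of [X t x]
    with the [i]-th slope is [t] or 0, up to a bounded term, and the velocity is
    found by inverting the matrix of slopes. The inverse is explicit. Each row of
    the cofactor matrix of [D] is divergence free ([divergence_cofactor], a
    consequence of the symmetry of second derivatives), so integration by parts on
    the torus shows that the mean of the [k]-th row has product with the [j]-th
    slope equal to the mean of [sigma] if [k] equals [j], and to 0 otherwise
    ([average_cofactor_slope]). In particular the mean of [sigma *: b] divided by
    the mean of [sigma] is the vector with product 1 with the first slope and 0
    with the others, which is the limit velocity ([asymptotic_velocity]).

    For the second part, replace one of the functions [v k], other than the first,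
    by the linear function with gradient [lambda]. The first row of the new
    cofactor matrix is again divergence free, and because [b] is orthogonal to
    [lambda] it is a scalar multiple of [sigma *: b]; the scalar is the [k]-th
    coordinate of [lambda] in the basis of the gradients. Since both fields are
    divergence free, this coordinate is constant along the flow
    ([tilt_ratio_transport]). If the flow is ergodic, each coordinate is a
    constant, and one of them is not 0 as [lambda] is not. Thus [sigma *: b] is a
    constant multiple of the new row ([ergodic_tilt]), which is a constant vector
    in dimension 2, and is the cross product of [lambda] with a gradient, up to
    sign, in dimension 3. *)

Set Implicit Arguments.
Unset Strict Implicit.
Unset Printing Implicit Defensive.

(** * Partial derivatives and the symmetry of second derivatives *)

Section calculus.
Context {R : realType} {d : nat}.
Implicit Types (f g : 'rV[R]_d -> R) (x v : 'rV[R]_d).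

Local Notation e i := (delta_mx ord0 i : 'rV[R]_d).

Lemma is_derive_line f x v (t : R) : derivable f (x + t *: v) v ->
  is_derive t (1 : R) (fun s => f (x + s *: v)) ('D_v f (x + t *: v)).
Proof.
move=> fd.
have E : (fun h : R => h^-1 *: (((fun s => f (x + s *: v)) \o shift t) (h *: 1)
            - f (x + t *: v))) =
         (fun h : R => h^-1 *: ((f \o shift (x + t *: v)) (h *: v)
            - f (x + t *: v))).
  apply/funext => h /=; congr (_ *: (f _ - _)).
  by rewrite scalerDl [h *: 1]mulr1 addrCA.
by apply: DeriveDef; [rewrite /derivable E|rewrite /derive E].
Qed.

Lemma derive_dotmul_grad f x v : differentiable f x ->
  'D_v f x = dotmul v (grad f x).
Proof.
move=> df; rewrite deriveE// [in LHS](row_sum_delta v) linear_sum/=.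
by apply: eq_bigr => i _; rewrite linearZ/= mxE deriveE.
Qed.

Lemma is_derive_curve f (c : R -> 'rV[R]_d) t v :
  differentiable f (c t) -> is_derive t (1 : R) c v ->
  is_derive t (1 : R) (f \o c) (dotmul v (grad f (c t))).
Proof.
move=> df [/derivable1_diffP dc <-].
have dfc : differentiable (f \o c) t by exact: differentiable_comp.
apply: DeriveDef; first exact/derivable1_diffP.
by rewrite !deriveE// diff_comp//= -derive_dotmul_grad// deriveE.
Qed.

Lemma grad_eq0_cst f : (forall x, differentiable f x) ->
  (forall x, grad f x = 0) -> forall x y, f x = f y.
Proof.
move=> df gf0 x y.
have /(_ 0 1) := @is_derive_0_is_cst _ (fun s : R => f (x + s *: (y - x))).
rewrite scale0r addr0 scale1r subrKC; apply=> t.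
apply: is_derive_eq; first by apply: is_derive_line; exact: diff_derivable.
rewrite derive_dotmul_grad// gf0 /dotmul big1// => i _.
by rewrite [X in _ * X]mxE mulr0.
Qed.

(** The mean value theorem is used twice, first in the direction [u] for the
    increment of [f] along [w], then in the direction [w] for ['D_u f]. *)
Lemma second_difference f x u w (h : R) : 0 <= h ->
  (forall y, derivable f y u) -> (forall y, derivable ('D_u f) y w) ->
  exists2 s : R * R, 0 <= s.1 <= h /\ 0 <= s.2 <= h &
    f (x + h *: u + h *: w) - (f (x + h *: u) + f (x + h *: w)) + f x =
    'D_w ('D_u f) (x + s.1 *: u + s.2 *: w) * h * h.
Proof.
move=> h0 fu fuw.
pose phi (s : R) := f (x + h *: w + s *: u) - f (x + s *: u).
have dphi s : is_derive s (1 : R) phi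
    ('D_u f (x + h *: w + s *: u) - 'D_u f (x + s *: u)).
  by apply: is_deriveB; exact: is_derive_line.
have [|s1] := MVT_segment h0 (fun s _ => dphi s).
  apply: continuous_subspaceT => s.
  exact/differentiable_continuous/derivable1_diffP/ex_derive.
rewrite in_itv/= => s1h E1.
have dpsi s : is_derive s (1 : R) (fun s => 'D_u f (x + s1 *: u + s *: w))
    ('D_w ('D_u f) (x + s1 *: u + s *: w)) by exact: is_derive_line.
have [|s2] := MVT_segment h0 (fun s _ => dpsi s).
  apply: continuous_subspaceT => s.
  exact/differentiable_continuous/derivable1_diffP/ex_derive.
rewrite in_itv/= => s2h E2.
exists (s1, s2) => //=.
rewrite scale0r addr0 !subr0 in E2; rewrite subr0 in E1.
rewrite -E2 (addrAC x (s1 *: u)) -E1 /phi scale0r !addr0.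
by rewrite (addrAC x (h *: w)); ring.
Qed.

(** The second difference is symmetric in the two directions, and both iterated
    derivatives are limits of it, divided by [h * h], as [h] goes to 0. *)
Lemma derive_comm f x u w :
  (forall y, derivable f y u) -> (forall y, derivable f y w) ->
  (forall y, derivable ('D_u f) y w) -> (forall y, derivable ('D_w f) y u) ->
  continuous ('D_w ('D_u f)) -> continuous ('D_u ('D_w f)) ->
  'D_w ('D_u f) x = 'D_u ('D_w f) x.
Proof.
move=> fu fw fuw fwu cuw cwu; apply/eqP; rewrite -subr_eq0 -normr_le0.
apply/ler_addgt0Pr => eps eps0; rewrite add0r.
have close (g : 'rV[R]_d -> R) : continuous g ->
    \forall y \near x, `|g x - g y| < eps / 2.
  by move=> /(_ x) /cvgrPdist_lt; apply; exact: divr_gt0.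
have [r /= r0 Hr] : nbhs_ball x (fun y =>
    `|'D_w ('D_u f) x - 'D_w ('D_u f) y| < eps / 2 /\
    `|'D_u ('D_w f) x - 'D_u ('D_w f) y| < eps / 2).
  by apply/nbhs_ballP; exact: filterI (close _ cuw) (close _ cwu).
(* A parallelogram with sides [h *: u] and [h *: w] stays in the ball of radius
   [r] because [h * C = r / 2]; the summand 1 keeps [C] positive. *)
pose C := `|u| + `|w| + 1.
have C0 : 0 < C by rewrite ltr_pwDr// addr_ge0.
pose h := r / 2 / C.
have h0 : 0 < h by rewrite !divr_gt0.
have near_x (s1 s2 : R) : 0 <= s1 <= h -> 0 <= s2 <= h ->
    ball x r (x + (s1 *: u + s2 *: w)).
  move=> /andP[s10 s1h] /andP[s20 s2h].
  rewrite -ball_normE/= opprD addNKr normrN.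
  apply: le_lt_trans (ler_normD _ _) _; rewrite !normrZ !ger0_norm//.
  apply: (@le_lt_trans _ _ (h * C)); last first.
    by rewrite /h divfK ?gt_eqF// ltr_pdivrMr// ltr_pMr// ltr1n.
  rewrite /C mulrDr mulr1 mulrDr -[leLHS]addr0.
  by rewrite !lerD ?ler_wpM2r// ltW.
have [[s1 s2] /= [s1h s2h] E1] := second_difference x (ltW h0) fu fuw.
have [[t1 t2] /= [t1h t2h] E2] := second_difference x (ltW h0) fw fwu.
have E : 'D_w ('D_u f) (x + (s1 *: u + s2 *: w)) =
         'D_u ('D_w f) (x + (t2 *: u + t1 *: w)).
  apply: (mulIf (lt0r_neq0 h0)); apply: (mulIf (lt0r_neq0 h0)).
  rewrite [t2 *: u + _]addrC !addrA; apply: etrans (esym E1) _.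
  by apply: etrans _ E2; rewrite (addrAC x) [f (x + h *: u) + _]addrC.
have [H1 _] := Hr _ (near_x _ _ s1h s2h).
have [_ H2] := Hr _ (near_x _ _ t2h t1h).
rewrite -E distrC in H2; rewrite [eps]splitr.
exact: le_trans (ler_distD _ _ _) (lerD (ltW H1) (ltW H2)).
Qed.

Lemma Schwarz f (i j : 'I_d) x : Ck 2 f ->
  'D_(e j) ('D_(e i) f) x = 'D_(e i) ('D_(e j) f) x.
Proof.
move=> [df d2f]; apply: derive_comm => [y|y|y|y||].
- exact: diff_derivable.
- exact: diff_derivable.
- by apply: diff_derivable; case: (d2f i).
- by apply: diff_derivable; case: (d2f j).
- by case: (d2f i) => _; exact.
- by case: (d2f j) => _; exact.
Qed.

End calculus.

(** * Determinants with one row replaced, and Cramer's rule *)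

Section row_replacement.
Context {R : realType} {m : nat}.
Implicit Types (A : 'M[R]_m) (y z : 'rV[R]_m).

Definition replace_row A k y : 'M[R]_m :=
  \matrix_i (if i == k then y else row i A).

Lemma replace_row_id A k : replace_row A k (row k A) = A.
Proof. by apply/matrixP => i j; rewrite !mxE; case: eqP => [->|_]; rewrite mxE. Qed.

Lemma det_replace_row A k y :
  \det (replace_row A k y) = dotmul y (\row_j cofactor A k j).
Proof.
rewrite (expand_det_row _ k); apply: eq_bigr => j _.
rewrite !mxE eqxx; congr (_ * _); rewrite /cofactor; congr (_ * \det _).
apply/matrixP => p q; rewrite !mxE.
by rewrite eq_sym (negPf (neq_lift _ _)) mxE.
Qed.

Lemma dotmul_delta (j : 'I_m) y : dotmul (delta_mx ord0 j) y = y ord0 j.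
Proof.
rewrite /dotmul (bigD1 j)//= big1 => [|i ij]; first by rewrite mxE !eqxx mul1r addr0.
by rewrite mxE (negPf ij) andbF mul0r.
Qed.

Lemma cofactor_replace_row A k j :
  cofactor A k j = \det (replace_row A k (delta_mx ord0 j)).
Proof. by rewrite det_replace_row dotmul_delta mxE. Qed.

Lemma det_replace_row_row A k i : i != k ->
  \det (replace_row A k (row i A)) = 0.
Proof.
move=> ik; apply: (determinant_alternate ik) => j.
by rewrite !mxE eqxx (negPf ik).
Qed.

Lemma det_replace_rowC A i k y z : i != k ->
  \det (replace_row (replace_row A k y) i z) =
  - \det (replace_row (replace_row A k z) i y).
Proof.
move=> ik; rewrite (_ : replace_row (replace_row A k y) i z =
    xrow i k (replace_row (replace_row A k z) i y)).
  by rewrite xrowE det_mulmx det_perm odd_tperm ik mulN1r.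
apply/matrixP => p q; rewrite !mxE.
case: tpermP => [->|->|/eqP/negPf pi /eqP/negPf pk].
- by rewrite eqxx (eq_sym k) (negPf ik) !mxE eqxx.
- by rewrite eqxx (eq_sym k) (negPf ik) !mxE eqxx.
- by rewrite pi !mxE pk.
Qed.

(** A vector is determined by its products with the rows of an invertible [A].
    The two sides, as vectors indexed by [j], have the same products: with row
    [i] by definition of [replace_row], with row [k] because the exchange of two
    rows turns the determinant into that of [yi], and with the other rows
    because a row is then repeated. *)
Lemma cofactor_replace_other A i k y j : i != k -> \det A != 0 ->
  \det (replace_row A i y) = 0 ->
  \det A * cofactor (replace_row A k y) i j =
  \det (replace_row A k y) * cofactor A i j.
Proof.
move=> ik A0 yi.
pose g B : 'rV[R]_m := \row_j cofactor B i j.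
set c := \det (replace_row A k y).
pose z := \det A *: g (replace_row A k y) - c *: g A.
have dz l : dotmul (row l A) z =
    \det A * \det (replace_row (replace_row A k y) i (row l A)) -
    c * \det (replace_row A i (row l A)).
  rewrite !det_replace_row /dotmul !mulr_sumr -sumrB; apply: eq_bigr => q _.
  by rewrite !mxE; ring.
suff z0 : z = 0.
  by move/rowP/(_ j) : z0; rewrite !mxE => /eqP; rewrite subr_eq0 => /eqP.
apply/trmx_inj/(can_inj (mulKmx _)); first by rewrite unitmxE unitfE; exact: A0.
rewrite trmx0 mulmx0; apply/colP => l; rewrite [RHS]mxE.
transitivity (dotmul (row l A) z).
  by rewrite mxE; apply: eq_bigr => q _; rewrite !mxE.
have rowE p : p != k -> row p A = row p (replace_row A k y).
  by move=> pk; apply/rowP => q; rewrite !mxE (negPf pk) mxE.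
rewrite dz; have [->|li] := eqVneq l i.
  by rewrite {1}rowE// !replace_row_id /c; ring.
rewrite (det_replace_row_row A li) mulr0 subr0; have [->|lk] := eqVneq l k.
  by rewrite det_replace_rowC// replace_row_id yi oppr0 mulr0.
by rewrite rowE// det_replace_row_row// mulr0.
Qed.

Lemma det_replace_row_all0 A y : \det A != 0 ->
  (forall i, \det (replace_row A i y) = 0) -> y = 0.
Proof.
move=> A0 yA; have : y *m \adj A = 0.
  apply/rowP => i; rewrite [RHS]mxE -(yA i) det_replace_row mxE.
  by apply: eq_bigr => j _; rewrite !mxE.
move=> /(congr1 (mulmx^~ A)); rewrite mul0mx -mulmxA mul_adj_mx.
by rewrite mul_mx_scalar => /eqP; rewrite scaler_eq0 (negPf A0) => /eqP.
Qed.

End row_replacement.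

(** * Functions of class C1 *)

Section continuously_differentiable.
Context {R : realType} {d : nat}.
Implicit Types (f g : 'rV[R]_d -> R) (x v : 'rV[R]_d).

Local Notation e i := (delta_mx ord0 i : 'rV[R]_d).

Lemma Ck1_derivable f x v : Ck 1 f -> derivable f x v.
Proof. by move=> [df _]; exact: diff_derivable. Qed.

Lemma Ck1_continuous f : Ck 1 f -> continuous f.
Proof. by move=> [df _] x; exact: differentiable_continuous. Qed.

Lemma Ck2_Ck1 f : Ck 2 f -> Ck 1 f.
Proof.
by move=> [df d2f]; split=> // i; apply: Ck1_continuous; exact: d2f.
Qed.

Lemma Ck2_grad f i : Ck 2 f -> Ck 1 (fun x => grad f x ord0 i).
Proof.
by move=> [_ /(_ i) d2f]; rewrite (_ : (fun _ => _) = 'D_(e i) f)//;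
  apply/funext => x; rewrite mxE.
Qed.

Lemma Ck1_cst (c : R) : Ck 1 (fun _ : 'rV[R]_d => c).
Proof.
split=> [x|i]; first exact: differentiable_cst.
rewrite (_ : (fun _ => _) = fun _ : 'rV[R]_d => 0 : R).
  by move=> x; apply: cst_continuous.
by apply/funext => x; exact: derive_cst.
Qed.

Let continuous_add f g : continuous f -> continuous g ->
  continuous (fun x => f x + g x).
Proof. by move=> cf cg x; exact: (cvgD (cf x) (cg x)). Qed.

Let continuous_mul f g : continuous f -> continuous g ->
  continuous (fun x => f x * g x).
Proof. by move=> cf cg x; exact: (cvgM (cf x) (cg x)). Qed.

Lemma Ck1D f g : Ck 1 f -> Ck 1 g -> Ck 1 (fun x => f x + g x).
Proof.
move=> Cf Cg; have [[df cf] [dg cg]] := (Cf, Cg).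
split=> [x|i]; first exact: differentiableD.
rewrite (_ : (fun _ => _) = (fun x => 'D_(e i) f x + 'D_(e i) g x)).
  exact: (continuous_add (cf i) (cg i)).
by apply/funext => x; rewrite -deriveD//; exact: Ck1_derivable.
Qed.

Lemma Ck1M f g : Ck 1 f -> Ck 1 g -> Ck 1 (fun x => f x * g x).
Proof.
move=> Cf Cg; have [[df cf] [dg cg]] := (Cf, Cg).
split=> [x|i]; first exact: differentiableM.
rewrite (_ : (fun _ => _) =
    (fun x => f x * 'D_(e i) g x + g x * 'D_(e i) f x)).
  apply: continuous_add.
    exact: (continuous_mul (Ck1_continuous Cf) (cg i)).
  exact: (continuous_mul (Ck1_continuous Cg) (cf i)).
by apply/funext => x; rewrite deriveM//; exact: Ck1_derivable.
Qed.

Lemma Ck1_sum (I : Type) (r : seq I) (F : I -> 'rV[R]_d -> R) :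
  (forall i, Ck 1 (F i)) -> Ck 1 (fun x => \sum_(i <- r) F i x).
Proof.
move=> CF; elim: r => [|i r IH].
  by under eq_fun do rewrite big_nil; exact: Ck1_cst.
by under eq_fun do rewrite big_cons; exact: Ck1D.
Qed.

Lemma Ck1_prod (I : Type) (r : seq I) (F : I -> 'rV[R]_d -> R) :
  (forall i, Ck 1 (F i)) -> Ck 1 (fun x => \prod_(i <- r) F i x).
Proof.
move=> CF; elim: r => [|i r IH].
  by under eq_fun do rewrite big_nil; exact: Ck1_cst.
by under eq_fun do rewrite big_cons; exact: Ck1M.
Qed.

Lemma Ck1_det m (N : 'rV[R]_d -> 'M[R]_m) :
  (forall i j, Ck 1 (fun x => N x i j)) -> Ck 1 (fun x => \det (N x)).
Proof.
move=> CN; apply: Ck1_sum => s; apply: Ck1M; first exact: Ck1_cst.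
exact: Ck1_prod.
Qed.

Lemma is_derive_bigsum (I : Type) (r : seq I) (F : I -> 'rV[R]_d -> R)
    (dF : I -> R) x v : (forall i, is_derive x v (F i) (dF i)) ->
  is_derive x v (fun y => \sum_(i <- r) F i y) (\sum_(i <- r) dF i).
Proof.
move=> HF; elim: r => [|i r IH].
  under eq_fun do rewrite big_nil; rewrite big_nil; exact: is_derive_cst.
by under eq_fun do rewrite big_cons; rewrite big_cons; exact: is_deriveD.
Qed.

Lemma is_derive_bigprod m (F : 'I_m -> 'rV[R]_d -> R) (dF : 'I_m -> R) x v :
  (forall i, is_derive x v (F i) (dF i)) ->
  is_derive x v (fun y => \prod_i F i y)
    (\sum_i \prod_k (if k == i then dF k else F k x)).
Proof.
elim: m F dF => [|m IH] F dF HF.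
  under eq_fun do rewrite big_ord0; rewrite big_ord0; exact: is_derive_cst.
under eq_fun do rewrite big_ord_recl.
apply: (is_derive_eq (is_deriveM (HF ord0) (IH _ _ (fun i => HF (lift ord0 i))))).
rewrite addrC big_ord_recl big_ord_recl/=; congr (_ + _).
  by rewrite mulrC; congr (_ * _); apply: eq_bigr => k _.
rewrite /GRing.scale/= mulr_sumr; apply: eq_bigr => i _.
by rewrite big_ord_recl/=; congr (_ * _); apply: eq_bigr => k _.
Qed.

(** Each product in the Leibniz formula has one entry of each row, so the product
    rule differentiates one row at a time. *)
Lemma is_derive_det m (N : 'rV[R]_d -> 'M[R]_m) (dN : 'M[R]_m) x v :
  (forall i j, is_derive x v (fun y => N y i j) (dN i j)) ->
  is_derive x v (fun y => \det (N y))
    (\sum_i \det (replace_row (N x) i (row i dN))).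
Proof.
move=> HN; rewrite exchange_big/=.
apply: is_derive_bigsum => /= s.
have HP := is_derive_bigprod (fun i => HN i (s i)).
apply: (is_derive_eq (is_deriveZ ((-1) ^+ s : R) HP)).
rewrite /GRing.scale/= mulr_sumr; apply: eq_bigr => i _.
congr (_ * _); apply: eq_bigr => k _.
by rewrite mxE; case: eqP => [->|]; rewrite mxE.
Qed.

End continuously_differentiable.

(** * The rows of the cofactor matrix of a gradient are divergence free *)

Section cofactor_fields.
Context {R : realType} {d : nat}.
Implicit Types (u : 'I_d -> 'rV[R]_d -> R) (x : 'rV[R]_d).

Local Notation e i := (delta_mx ord0 i : 'rV[R]_d).

Definition jacobian_mx u x : 'M[R]_d := \matrix_i grad (u i) x.

Definition cofactor_field u k x : 'rV[R]_d := \row_j cofactor (jacobian_mx u x) k j.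

Lemma jacobian_mxE u x i j : jacobian_mx u x i j = 'D_(e j) (u i) x.
Proof. by rewrite !mxE. Qed.

Lemma Ck1_jacobian u i j : (forall i, Ck 2 (u i)) ->
  Ck 1 (fun x => jacobian_mx u x i j).
Proof.
move=> Cu; under eq_fun do rewrite mxE; exact: Ck2_grad.
Qed.

Lemma Ck1_cofactor u k j : (forall i, Ck 2 (u i)) ->
  Ck 1 (fun x => cofactor_field u k x ord0 j).
Proof.
move=> Cu; under eq_fun do rewrite mxE cofactor_replace_row.
apply: Ck1_det => p q; under eq_fun do rewrite mxE.
case: eqP => _; first exact: Ck1_cst.
by under eq_fun do rewrite mxE; exact: Ck1_jacobian.
Qed.

(** Piola's identity. The derivative of a cofactor replaces one more row [i] by
    second derivatives [H i j l], so the divergence is a sum of products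
    [H i j l * E i j l], with [H] symmetric in [j, l] by Schwarz's theorem and
    [E] antisymmetric since it is a determinant with the basis vectors [j] and
    [l] as rows. *)
Lemma divergence_cofactor u k x : (forall i, Ck 2 (u i)) ->
  \sum_j 'D_(e j) (fun y => cofactor_field u k y ord0 j) x = 0.
Proof.
move=> Cu; set A := jacobian_mx u x.
pose H i j l : R := 'D_(e j) ('D_(e l) (u i)) x.
have HC i j l : H i j l = H i l j by exact: Schwarz.
pose E i j l : R := \det (replace_row (replace_row A k (e j)) i (e l)).
have EC i j l : i != k -> E i j l = - E i l j by exact: det_replace_rowC.
have D j : 'D_(e j) (fun y => cofactor_field u k y ord0 j) x =
    \sum_(i | i != k) \sum_l H i j l * E i j l.
  rewrite (_ : (fun _ => _) =
      fun y => \det (replace_row (jacobian_mx u y) k (e j))); last first.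
    by apply/funext => y; rewrite mxE cofactor_replace_row.
  have dN i l : is_derive x (e j)
      (fun y => replace_row (jacobian_mx u y) k (e j) i l)
      ((\matrix_(i, l) if i == k then 0 else H i j l) i l).
    rewrite mxE; under eq_fun do rewrite mxE.
    case: eqP => _; first exact: is_derive_cst.
    under eq_fun do rewrite mxE jacobian_mxE.
    by apply: derivableP; apply: diff_derivable; case: (Cu i) => _ /(_ l) [].
  have [_ ->] := is_derive_det dN.
  rewrite (bigD1 k)//= det_replace_row /dotmul big1 ?add0r => [|l _].
    apply: eq_bigr => i ik; rewrite det_replace_row; apply: eq_bigr => l _.
    by rewrite !mxE (negPf ik) cofactor_replace_row.
  by rewrite !mxE eqxx mul0r.
under eq_bigr do rewrite D; rewrite exchange_big/= big1// => i ik.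
set S := (X in X = 0).
have : S = - S.
  rewrite {1}/S exchange_big/= /S -sumrN; apply: eq_bigr => j _.
  by rewrite -sumrN; apply: eq_bigr => l _; rewrite HC EC// mulrN.
by move/eqP; rewrite -addr_eq0 -mulr2n mulrn_eq0 => /eqP.
Qed.

End cofactor_fields.

(** * Continuous functions of several variables are Borel *)

Section row_measurability.
Context {R : realType} {n : nat}.
Implicit Types (x y : 'rV[R]_n) (A : set 'rV[R]_n).

Definition open_box x (r : R) : set 'rV[R]_n :=
  [set y | forall i, `|x ord0 i - y ord0 i| < r].

Lemma nbhs_open_box x A : nbhs x A -> exists2 r : R, 0 < r & open_box x r `<=` A.
Proof.
move=> /nbhs_ballP[r /= r0 rA]; exists r => // y xy; apply: rA.
by split=> // i j; rewrite !ord1; exact: xy.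
Qed.

Lemma open_boxE x r : open_box x r =
  [set y | forall i, `]x ord0 i - r, x ord0 i + r[%classic (y ord0 i)].
Proof.
by apply/seteqP; split=> y xy i; have := xy i;
  rewrite /= in_itv/= distrC ltr_distl.
Qed.

Lemma measurable_rows (A : 'I_n -> set R) : (forall i, measurable (A i)) ->
  measurable [set x : 'rV[R]_n | forall i, A i (x ord0 i)].
Proof.
move=> mA; rewrite (_ : [set _ | _] =
    \bigcap_(i in [set: 'I_n]) (fun x : 'rV[R]_n => x ord0 i) @^-1` A i).
  apply: fin_bigcap_measurable => // i _.
  by rewrite -[X in measurable X]setTI; exact: measurable_coord.
by apply/seteqP; split=> [x Ax i _|x Ax i]; [exact: Ax|exact: (Ax i I)].
Qed.

Lemma measurable_unit_cell : measurable (@unit_cell R n).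
Proof.
rewrite (_ : unit_cell = [set x | forall i, (fun=> `[0, 1[%classic) i (x ord0 i)]).
  exact: (measurable_rows (fun=> measurable_itv _)).
by apply/seteqP; split=> x xY i; have := xY i; rewrite /= in_itv.
Qed.

(** Boxes with rational centre and radius [k.+1^-1] form a countable base. *)
Lemma open_measurable_row A : open A -> measurable A.
Proof.
move=> oA; pose B (qk : 'rV[rat]_n * nat) : set 'rV[R]_n :=
  open_box (map_mx ratr qk.1) (qk.2.+1%:R^-1).
rewrite (_ : A = \bigcup_(qk in [set qk | B qk `<=` A]) B qk).
  rewrite bigcup_mkcond; apply: countable_bigcupT_measurable => [|qk].
    exact: countableP.
  case: ifP => // _; rewrite /B open_boxE.
  exact: (measurable_rows (fun=> measurable_itv _)).
apply/seteqP; split=> [x Ax|x [qk BA /BA]//].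
have [r r0 rA] : exists2 r : R, 0 < r & open_box x r `<=` A.
  by apply: nbhs_open_box; rewrite openE in oA; exact: oA.
have [k kr] : exists k, k.+1%:R^-1 < r / 2.
  have [k _ Hk] := near_infty_natSinv_lt (PosNum (divr_gt0 r0 (ltr0Sn R 1))).
  by exists k; exact: (Hk k (leqnn k)).
have k0 : (0 : R) < k.+1%:R^-1 by rewrite invr_gt0.
have /choice[q Hq] : forall i, exists q : rat, `|ratr q - x ord0 i| < k.+1%:R^-1.
  move=> i; have : x ord0 i - k.+1%:R^-1 < x ord0 i + k.+1%:R^-1 by rewrite ltrD2l gtrN.
  by move=> /rat_in_itvoo[q]; rewrite in_itv/= -ltr_distl; exists q.
exists (\row_i q i, k) => [y|i] /=; last by rewrite !mxE; exact: Hq.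
move=> Hy; apply: rA => i; have := Hy i; rewrite !mxE => {}Hy.
rewrite (splitr r) (le_lt_trans (ler_distD (ratr (q i)) _ _))//.
by rewrite ltrD ?(lt_trans _ kr)// distrC.
Qed.

Lemma continuous_measurable_row (f : 'rV[R]_n -> R) : continuous f ->
  measurable_fun [set: 'rV[R]_n] f.
Proof.
move=> /continuousP cf; apply: (measurability _ (RGenOInfty.measurableE R)).
move=> _ [_ [a ->] <-]; rewrite setTI.
by apply: open_measurable_row; apply: cf; exact: interval_open.
Qed.

(** The set where [f] differs from [c] is open, so if it is not empty it contains
    a box, which has positive measure. *)
Lemma continuous_ae_cst (f : 'rV[R]_n -> R) c : continuous f ->
  (\forall x \ae lebesgue_row n, f x = c) -> forall x, f x = c.
Proof.
move=> cf [A [mA A0 fA]] x; apply: contrapT => fxc.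
have : nbhs x [set y | f y != c].
  have /continuousP/(_ [set~ c]) := cf.
  have : open [set~ c].
    exact/closed_openC/accessible_closed_set1/hausdorff_accessible/Rhausdorff.
  move=> oc /(_ oc); rewrite openE => /(_ x)/=.
  by move=> /(_ fxc); apply: filterS => y /= /eqP.
move=> /nbhs_open_box[r r0 rf].
have : (lebesgue_row n (open_box x r) <= lebesgue_row n A)%E.
  apply: le_measure; rewrite ?inE//.
    by rewrite open_boxE; exact: (measurable_rows (fun=> measurable_itv _)).
  by move=> y /rf/= /eqP fy; apply: fA.
rewrite A0 open_boxE.
rewrite (@lebesgue_row_box _ _ (fun i => `]x ord0 i - r, x ord0 i + r[%classic))//.
rewrite leNgt => /negP; apply.
elim/big_ind: _ => [|a c'|i _]; [exact: lte01|exact: mule_gt0|].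
rewrite lebesgue_measure_itv/= lte_fin.
by rewrite ltrD2l gtrN// -EFinB lte_fin opprB addrC addrA subrK addr_gt0.
Qed.

End row_measurability.

(** * Iterated integrals over the unit cell *)

Section unit_cell_integration.
Context {R : realType}.
Local Notation leb := (@lebesgue_measure R).

Lemma open_box_nbhs n (x : 'rV[R]_n) (r : R) : 0 < r -> nbhs x (open_box x r).
Proof.
move=> r0; apply/nbhs_ballP; exists r => //= y [_ xy] i; exact: xy.
Qed.

Lemma unit_cell_bounded n (f : 'rV[R]_n -> R) : continuous f ->
  exists B : R, forall x, unit_cell x -> `|f x| <= B.
Proof.
move=> cf; pose K := [set x : 'rV[R]_n | forall i, `[(0:R), 1]%classic (x ord0 i)].
have cK : compact K.
  apply: (@rV_compact _ _ (fun=> `[(0:R), 1]%classic)) => i.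
  exact: segment_compact.
have /compact_bounded[M [_ HM]] : compact (f @` K).
  by apply: continuous_compact cK; exact: continuous_subspaceT.
exists (`|M| + 1) => x Yx; apply: (HM (`|M| + 1)).
  by rewrite ltr_pwDr// ler_norm.
by exists x => // i; rewrite /= in_itv/=; have /andP[-> /ltW ->] := Yx i.
Qed.

Lemma integrable_unit_cell n (f : 'rV[R]_n -> R) : continuous f ->
  (lebesgue_row n).-integrable unit_cell (EFin \o f).
Proof.
move=> cf; apply: measurable_bounded_integrable.
- exact: measurable_unit_cell.
- by have := @lebesgue_unit_cell R n; rewrite /= => ->; rewrite ltry.
- by apply: measurable_funTS; exact: continuous_measurable_row.
have [B HB] := unit_cell_bounded cf.
exists B; split; first exact: num_real.
by move=> M BM x Yx /=; rewrite (le_trans _ (ltW BM))// HB.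
Qed.

Lemma unit_cell_cons n a (y : 'rV[R]_n) :
  unit_cell (cons_row (a, y)) <-> `[0, 1[%classic a /\ unit_cell y.
Proof.
rewrite /= in_itv/=; split=> [Y|[a01 Y] i].
  split; first by have := Y ord0; rewrite cons_row0.
  by move=> i; have := Y (lift ord0 i); rewrite cons_rowS.
by case: (unliftP ord0 i) => [j|] ->; rewrite ?cons_rowS ?cons_row0.
Qed.

Section fubini.
Variables (n : nat) (f : 'rV[R]_n.+1 -> R).
Hypothesis cf : continuous f.
Local Open Scope ereal_scope.

Let g : 'rV[R]_n.+1 -> \bar R := (EFin \o f) \_ unit_cell.

Let mg : measurable_fun [set: 'rV[R]_n.+1] g.
Proof.
apply/(measurable_restrictT _ _).1; first exact: measurable_unit_cell.
by apply/measurable_EFinP/measurable_funTS; exact: continuous_measurable_row.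
Qed.

Local Notation m := (leb \x lebesgue_row n)%E.

(* The same fact as [measurable_cons_row], for the presentation of the reals that
   carries [lebesgue_measure]. *)
Let mc : @measurable_fun _ _ (measurableTypeR R * 'rV[R]_n)%type 'rV[R]_n.+1
  setT (@cons_row R n) := @measurable_cons_row R n.

Let ig : m.-integrable setT (g \o @cons_row R n).
Proof.
have : (lebesgue_row n.+1).-integrable setT g.
  apply/(integrable_mkcond _ (@measurable_unit_cell R n.+1)).1.
  exact: integrable_unit_cell.
move=> /integrableP[_ gfin]; apply/integrableP; split.
  exact: (measurableT_comp mg mc).
have <- := @ge0_integral_pushforward _ _ _ _ _ _ mc m setT (abse \o g) measurableT
  (measurableT_comp (@abse_measurable R setT) mg) (fun x _ => abse_ge0 (g x)).
exact: gfin.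
Qed.

Let intE : \int[lebesgue_row n.+1]_(x in unit_cell) (f x)%:E = \int[m]_p g (cons_row p).
Proof.
rewrite integral_mkcond.
exact: (@integral_pushforward _ _ _ _ _ _ mc m setT g mg ig measurableT).
Qed.

Let gE a (y : 'rV[R]_n) : g (cons_row (a, y)) =
  if (a \in `[0%R, 1%R[%classic) && (y \in unit_cell)
  then (f (cons_row (a, y)))%:E else 0.
Proof.
rewrite /g patchE; congr (if _ then _ else _).
by apply/idP/andP => [/set_mem/unit_cell_cons[]|[]]; rewrite ?inE// => ? ?;
  apply/unit_cell_cons.
Qed.

(** Two orders of integration: the first coordinate is split off either to apply
    an induction hypothesis to the others or to integrate along it. *)
Lemma unit_cell_integral_eq0_tail :
  (forall a, \int[lebesgue_row n]_(y in unit_cell) (f (cons_row (a, y)))%:E = 0) ->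
  \int[lebesgue_row n.+1]_(x in unit_cell) (f x)%:E = 0.
Proof.
move=> f0; rewrite intE -integral12_prod_meas1//; apply: integral0_eq => a _.
rewrite /fubini_F; under eq_integral do rewrite /= gE.
case: (boolP (a \in _)) => _ /=; last exact: integral0.
by rewrite -[RHS](f0 a) [RHS]integral_mkcond; under [RHS]eq_integral do rewrite patchE.
Qed.

Lemma unit_cell_integral_eq0_head :
  (forall y, \int[leb]_(a in `[0%R, 1%R[) (f (cons_row (a, y)))%:E = 0) ->
  \int[lebesgue_row n.+1]_(x in unit_cell) (f x)%:E = 0.
Proof.
move=> f0; rewrite intE -integral21_prod_meas1//; apply: integral0_eq => y _.
rewrite /fubini_G; under eq_integral do rewrite /= gE andbC.
case: (boolP (y \in _)) => _ /=; last exact: integral0.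
by rewrite -[RHS](f0 y) [RHS]integral_mkcond; under [RHS]eq_integral do rewrite patchE.
Qed.

End fubini.

End unit_cell_integration.

(** * Averages over the unit cell *)

Section average.
Context {R : realType}.

Lemma continuous_cons_tail n (a : R) : continuous (fun y : 'rV[R]_n => cons_row (a, y)).
Proof.
move=> y A /nbhs_open_box[r r0 rA].
apply: filterS (open_box_nbhs y r0) => z yz; apply: rA => i.
by case: (unliftP ord0 i) => [j|] ->; rewrite ?cons_rowS ?cons_row0//= subrr normr0.
Qed.

Lemma continuous_line n (x v : 'rV[R]_n) : continuous (fun t : R => x + t *: v).
Proof.
by move=> t; apply: cvgD; [exact: cvg_cst|apply: cvgZr_tmp; exact: cvg_id].
Qed.

Lemma cons_row_head n a (y : 'rV[R]_n) :
  cons_row (a, y) = cons_row (0, y) + a *: delta_mx ord0 ord0.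
Proof.
apply/rowP => i; rewrite [RHS]mxE [X in _ + X]mxE [X in _ * X]mxE.
case: (unliftP ord0 i) => [j|] ->; rewrite ?cons_rowS ?cons_row0/=.
  by rewrite mulr0 addr0.
by rewrite mulr1 add0r.
Qed.

Lemma cons_row_tail n a (y : 'rV[R]_n) j (t : R) :
  cons_row (a, y + t *: delta_mx ord0 j) =
  cons_row (a, y) + t *: delta_mx ord0 (lift ord0 j).
Proof.
apply/rowP => i; rewrite [RHS]mxE [X in _ = _ + X]mxE [X in _ = _ + _ * X]mxE.
case: (unliftP ord0 i) => [k|] ->; rewrite ?cons_rowS ?cons_row0/=.
  by rewrite !mxE (inj_eq lift_inj).
by rewrite mulr0 addr0.
Qed.

Lemma FTC_periodic (F f : R -> R) : (forall t, is_derive t (1 : R) F (f t)) ->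
  continuous f -> F 1 = F 0 ->
  (\int[@lebesgue_measure R]_(t in `[0%R, 1%R[) (f t)%:E = 0)%E.
Proof.
move=> dF cf F10.
have cF : continuous F.
  by move=> t; apply/differentiable_continuous/derivable1_diffP; case: (dF t).
rewrite integral_itv_bndo_bndc; last first.
  by apply/measurable_EFinP/measurable_funTS; exact: continuous_measurable_fun.
rewrite (@continuous_FTC2 _ f F)//.
- by rewrite F10 subee.
- exact: continuous_subspaceT.
- split=> [t _||]; first by case: (dF t).
    exact/cvg_at_right_filter/cF.
  exact/cvg_at_left_filter/cF.
- by move=> t _; rewrite derive1E; case: (dF t).
Qed.

(** Integrating first in the [i]-th variable gives the increment of [g] over one
    period, which is 0. The induction on [n] peels off the variables before it. *)
Lemma integral_partial_eq0 n (i : 'I_n) (g : 'rV[R]_n -> R) :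
  (forall x, derivable g x (delta_mx ord0 i)) ->
  continuous ('D_(delta_mx ord0 i) g) ->
  (forall x, g (x + delta_mx ord0 i) = g x) ->
  (\int[lebesgue_row n]_(x in unit_cell) ('D_(delta_mx ord0 i) g x)%:E = 0)%E.
Proof.
elim: n i g => [[]//|n IH] i g dg cg pg.
case: (unliftP ord0 i) => [j|] ij; rewrite ij in dg cg pg *.
  apply: unit_cell_integral_eq0_tail => // a.
  pose g' (y : 'rV[R]_n) := g (cons_row (a, y)).
  have Hg' y : is_derive y (delta_mx ord0 j) g'
      ('D_(delta_mx ord0 (lift ord0 j)) g (cons_row (a, y))).
    have E : (fun h : R => h^-1 *: ((g' \o shift y) (h *: delta_mx ord0 j) - g' y))
        = (fun h : R => h^-1 *: ((g \o shift (cons_row (a, y)))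
            (h *: delta_mx ord0 (lift ord0 j)) - g (cons_row (a, y)))).
      by apply/funext => h /=; rewrite ![_ *: delta_mx _ _ + _]addrC /g' cons_row_tail.
    by apply: DeriveDef; [rewrite /derivable E; exact: dg|rewrite /derive E].
  have DE : 'D_(delta_mx ord0 j) g' =
      'D_(delta_mx ord0 (lift ord0 j)) g \o (fun y => cons_row (a, y)).
    by apply/funext => y; case: (Hg' y).
  under eq_integral do rewrite -[X in X%:E]/(('D_(delta_mx ord0 (lift ord0 j)) g
      \o (fun y : 'rV[R]_n => cons_row (a, y))) _) -DE.
  apply: IH => [y||y]; first by case: (Hg' y).
    rewrite DE => y; apply: continuous_comp; first exact: continuous_cons_tail.
    exact: cg.
  by rewrite /g' -[delta_mx ord0 j]scale1r cons_row_tail scale1r.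
apply: unit_cell_integral_eq0_head => // y.
pose F (t : R) := g (cons_row (0, y) + t *: delta_mx ord0 ord0).
under eq_integral do rewrite cons_row_head.
apply: (@FTC_periodic F) => [t||].
- exact: (is_derive_line (dg _)).
- move=> t; apply: (@continuous_comp _ _ _ (fun t : R => cons_row (0, y) +
    t *: delta_mx ord0 ord0) ('D_(delta_mx ord0 ord0) g) t); last exact: cg.
  exact: continuous_line.
- by rewrite /F scale1r scale0r addr0.
Qed.

Lemma average_partial n (i : 'I_n) (g : 'rV[R]_n -> R) : Ck 1 g ->
  (forall x, g (x + delta_mx ord0 i) = g x) ->
  average ('D_(delta_mx ord0 i) g) = 0.
Proof.
move=> Cg pg; rewrite /average /Rintegral integral_partial_eq0//.
  by move=> x; exact: Ck1_derivable.
by case: Cg => _; exact.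
Qed.

Lemma averageD n (f g : 'rV[R]_n -> R) : continuous f -> continuous g ->
  average (fun x => f x + g x) = average f + average g.
Proof.
by move=> cf cg; apply: RintegralD; [exact: measurable_unit_cell|
  exact: integrable_unit_cell..].
Qed.

Lemma averageZ n c (f : 'rV[R]_n -> R) : continuous f ->
  average (fun x => c * f x) = c * average f.
Proof.
by move=> cf; apply: RintegralZl; [exact: measurable_unit_cell|
  exact: integrable_unit_cell].
Qed.

Lemma average_cst n c : average (fun _ : 'rV[R]_n => c) = c.
Proof.
rewrite /average Rintegral_cst; last exact: measurable_unit_cell.
by have := @lebesgue_unit_cell R n => /= ->; rewrite mulr1.
Qed.

Lemma average_sum n (I : Type) (r : seq I) (F : I -> 'rV[R]_n -> R) :
  (forall i, continuous (F i)) ->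
  average (fun x => \sum_(i <- r) F i x) = \sum_(i <- r) average (F i).
Proof.
move=> cF.
suff [] : continuous (fun x => \sum_(i <- r) F i x) /\
  average (fun x => \sum_(i <- r) F i x) = \sum_(i <- r) average (F i) by [].
elim: r => [|i r [cr IH]].
  under eq_fun do rewrite big_nil; rewrite big_nil average_cst; split=> //.
  by move=> x; exact: cst_continuous.
under eq_fun do rewrite big_cons; rewrite big_cons averageD// IH; split=> //.
by move=> x; exact: (cvgD (cF i x) (cr x)).
Qed.

Lemma average_gt0 n (f : 'rV[R]_n -> R) : continuous f ->
  (forall x, 0 < f x) -> 0 < average f.
Proof.
(* A bound of the inverse of [f] gives a positive lower bound of [f]. *)
move=> cf f0; have [B HB] : exists B : R, forall x, unit_cell x -> `|(f x)^-1| <= B.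
  apply: unit_cell_bounded => x; apply: continuousV; last exact: cf.
  by rewrite gt_eqF.
have Y0 : unit_cell (0 : 'rV[R]_n) by move=> i; rewrite mxE lexx ltr01.
have B0 : 0 < B.
  by apply: lt_le_trans (HB _ Y0); rewrite normr_gt0 invr_eq0 gt_eqF.
apply: (@lt_le_trans _ _ B^-1); first by rewrite invr_gt0.
rewrite -[leLHS](@average_cst n); apply: le_Rintegral.
- exact: measurable_unit_cell.
- by apply: integrable_unit_cell => x; exact: cst_continuous.
- exact: integrable_unit_cell.
move=> x Yx; rewrite -[leRHS]invrK lef_pV2 ?posrE ?invr_gt0//.
by apply: le_trans (HB _ Yx); exact: ler_norm.
Qed.

End average.

(** * Periodic functions *)

Section periodicity.
Context {R : realType} {d : nat}.
Implicit Types (f g : 'rV[R]_d -> R) (x v : 'rV[R]_d).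

Local Notation e i := (delta_mx ord0 i : 'rV[R]_d).

Lemma Yperiodic_delta (V : Type) (f : 'rV[R]_d -> V) i x :
  Yperiodic f -> f (x + e i) = f x.
Proof.
move=> pf; rewrite -[RHS](pf _ (delta_mx ord0 i)); congr (f (x + _)).
by apply/rowP => j; rewrite !mxE; case: (_ && _).
Qed.

Lemma delta_Yperiodic (V : Type) (f : 'rV[R]_d -> V) :
  (forall i x, f (x + e i) = f x) -> Yperiodic f.
Proof.
move=> pf x k; rewrite (row_sum_delta (map_mx intr k)).
under eq_bigr do rewrite mxE.
have pn i (m : nat) y : f (y + m%:R *: e i) = f y.
  elim: m y => [|m IH] y; first by rewrite scale0r addr0.
  by rewrite -natr1 scalerDl scale1r addrA pf IH.
have pz (i : 'I_d) y : f (y + (k ord0 i)%:~R *: e i) = f y.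
  case: (k ord0 i) => m; first exact: pn.
  by rewrite NegzE mulrNz scaleNr -[LHS](pn i m.+1) subrK.
have ps (r : seq 'I_d) y :
    f (y + \sum_(i <- r) (k ord0 i)%:~R *: e i) = f y.
  elim: r y => [|i r IH] y; first by rewrite big_nil addr0.
  by rewrite big_cons addrA IH pz.
exact: ps.
Qed.

Lemma unit_cell_translate x : exists k : 'rV[int]_d, unit_cell (x + map_mx intr k).
Proof.
exists (\row_i - Num.floor (x ord0 i)) => i.
rewrite !mxE mulrNz subr_ge0 ltrBlDl.
by rewrite floor_le -[1]/(1%:~R) -intrD floorD1_gt.
Qed.

Lemma Yperiodic_eq (V : Type) (f g : 'rV[R]_d -> V) : Yperiodic f -> Yperiodic g ->
  (forall x, unit_cell x -> f x = g x) -> forall x, f x = g x.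
Proof.
move=> pf pg fg x; have [k Yk] := unit_cell_translate x.
by rewrite -(pf x k) fg.
Qed.

Lemma Yperiodic_bounded f : continuous f -> Yperiodic f ->
  exists B : R, forall x, `|f x| <= B.
Proof.
move=> cf pf; have [B HB] := unit_cell_bounded cf; exists B => x.
by have [k /HB] := unit_cell_translate x; rewrite pf.
Qed.

Lemma derive_translate f x v a : 'D_v (fun y => f (y + a)) x = 'D_v f (x + a).
Proof.
rewrite /derive (_ : (fun h => h^-1 *: (((fun y => f (y + a)) \o shift x) (h *: v)
      - f (x + a))) =
  (fun h => h^-1 *: ((f \o shift (x + a)) (h *: v) - f (x + a))))//.
by apply/funext => h /=; rewrite addrA.
Qed.

Lemma Ck2_linear (y : 'rV[R]_d) : Ck 2 (fun x => dotmul x y) /\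
  forall x, grad (fun x => dotmul x y) x = y.
Proof.
have dcoord i x : differentiable (fun z : 'rV[R]_d => z ord0 i) x.
  exact: differentiable_coord.
have dy x : differentiable (fun z => dotmul z y) x.
  rewrite /dotmul (_ : (fun _ => _) =
    \sum_i (fun z : 'rV[R]_d => z ord0 i * y ord0 i)).
    by apply: differentiable_sum => i; apply: differentiableM.
  by apply/funext => z; rewrite fct_sumE.
have Dy x v : 'D_v (fun z => dotmul z y) x = dotmul v y.
  have /(_ x v) : forall x v, is_derive x v (fun z => dotmul z y) (dotmul v y).
    move=> {}x {}v; apply: is_derive_bigsum => i.
    have Hi : is_derive x v (fun z : 'rV[R]_d => z ord0 i) (v ord0 i).
      apply: DeriveDef; first exact: diff_derivable.
      have dx : derivable (id : 'rV[R]_d -> 'rV[R]_d) x v by exact: derivable_id.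
      have := derive_mx dx; rewrite derive_id => {2}->.
      by rewrite mxE.
    by apply: (is_derive_eq (is_deriveM Hi (is_derive_cst (y ord0 i) x v)));
      rewrite scaler0 add0r /GRing.scale/= mulrC.
  by case.
split; last first.
  by move=> x; apply/rowP => i; rewrite mxE Dy dotmul_delta.
split=> // i; rewrite (_ : (fun _ => _) = (fun=> y ord0 i)); first exact: Ck1_cst.
by apply/funext => x; rewrite Dy dotmul_delta.
Qed.

End periodicity.

(** * Functions with periodic gradient and their mean cofactors *)

Section mean_values.
Context {R : realType} {d : nat}.
Implicit Types (f : 'rV[R]_d -> R) (x : 'rV[R]_d).

Local Notation e i := (delta_mx ord0 i : 'rV[R]_d).

Lemma dotmulBr (x y z : 'rV[R]_d) : dotmul x (y - z) = dotmul x y - dotmul x z.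
Proof.
rewrite /dotmul -sumrB; apply: eq_bigr => i _.
by rewrite mxE [X in _ + X]mxE mulrBr.
Qed.

Lemma dotmulDl (x y z : 'rV[R]_d) : dotmul (x + y) z = dotmul x z + dotmul y z.
Proof.
by rewrite /dotmul -big_split/=; apply: eq_bigr => i _; rewrite mxE mulrDl.
Qed.

Lemma dotmulZl c (x y : 'rV[R]_d) : dotmul (c *: x) y = c * dotmul x y.
Proof. by rewrite /dotmul mulr_sumr; apply: eq_bigr => i _; rewrite mxE mulrA. Qed.

Lemma dotmulC (x y : 'rV[R]_d) : dotmul x y = dotmul y x.
Proof. by apply: eq_bigr => i _; rewrite mulrC. Qed.

Definition slope f : 'rV[R]_d := \row_i (f (e i) - f 0).

Definition fluctuation f x : R := f x - dotmul x (slope f).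

(** With a periodic gradient, the increment of [f] over a period does not depend
    on the starting point, and [slope f] collects these increments at 0. *)
Lemma fluctuation_periodic f : (forall x, differentiable f x) ->
  Yperiodic (grad f) -> Yperiodic (fluctuation f).
Proof.
move=> df pf; apply: delta_Yperiodic => i x; pose q y := f (y + e i) - f y.
have dfi y : differentiable (fun y => f (y + e i)) y.
  by apply: differentiable_comp => //; exact: differentiableD.
have qE : q x = q 0.
  apply: grad_eq0_cst => [y|y]; first exact: differentiableB.
  apply/rowP => j; rewrite !mxE deriveB; [|exact: diff_derivable..].
  rewrite derive_translate; apply/eqP; rewrite subr_eq0; apply/eqP.
  by have := Yperiodic_delta i y pf => /rowP/(_ j); rewrite !mxE.
have -> : fluctuation f (x + e i) = fluctuation f x + (q x - q 0).
  by rewrite /fluctuation dotmulDl dotmul_delta mxE /q add0r; ring.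
by rewrite qE subrr addr0.
Qed.

Lemma Ck1_fluctuation f : Ck 1 f -> Ck 1 (fluctuation f).
Proof.
move=> Cf; apply: (Ck1D Cf).
rewrite (_ : (fun _ => _) = fun x => (-1) * dotmul x (slope f)).
  by apply: Ck1M; [exact: Ck1_cst|apply: Ck2_Ck1; case: (Ck2_linear (slope f))].
by apply/funext => x; rewrite mulN1r.
Qed.

Lemma grad_fluctuation f x : differentiable f x ->
  grad (fluctuation f) x = grad f x - slope f.
Proof.
move=> df; have [[dl _] gl] := Ck2_linear (slope f).
rewrite -[X in _ - X](gl x); apply/rowP => j; rewrite !mxE.
by rewrite deriveB//; exact: diff_derivable.
Qed.

Section cofactor_means.
Variable u : 'I_d -> 'rV[R]_d -> R.
Hypotheses (u_C2 : forall i, Ck 2 (u i)) (u_per : forall i, Yperiodic (grad (u i))).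

Lemma jacobian_periodic : Yperiodic (jacobian_mx u).
Proof. by move=> x k; apply/matrixP => i j; rewrite mxE u_per [RHS]mxE. Qed.

Lemma cofactor_field_periodic k : Yperiodic (cofactor_field u k).
Proof. by move=> x m; rewrite /cofactor_field jacobian_periodic. Qed.

Lemma continuous_cofactor k j : continuous (fun x => cofactor_field u k x ord0 j).
Proof. exact/Ck1_continuous/Ck1_cofactor. Qed.

(** Integration by parts on the torus against a divergence-free field. *)
Lemma average_cofactor_grad k f : Ck 1 f -> Yperiodic f ->
  average (fun x => dotmul (cofactor_field u k x) (grad f x)) = 0.
Proof.
move=> Cf pf; have Cc j := Ck1_cofactor k j u_C2.
pose g j x := cofactor_field u k x ord0 j * f x.
have Cg j : Ck 1 (g j) by exact: Ck1M.
have -> : (fun x => dotmul (cofactor_field u k x) (grad f x)) =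
    (fun x => \sum_j 'D_(e j) (g j) x).
  apply/funext => x; transitivity (dotmul (cofactor_field u k x) (grad f x) +
      f x * \sum_j 'D_(e j) (fun y => cofactor_field u k y ord0 j) x).
    by rewrite divergence_cofactor// mulr0 addr0.
  rewrite /dotmul mulr_sumr -big_split/=; apply: eq_bigr => j _.
  by rewrite deriveM; [rewrite [grad f x ord0 j]mxE|exact: Ck1_derivable..].
rewrite average_sum => [|j]; last by case: (Cg j) => _; exact.
rewrite big1// => j _; apply: average_partial => // x.
by rewrite /g (Yperiodic_delta _ _ pf) (Yperiodic_delta _ _ (cofactor_field_periodic k)).
Qed.

Lemma dotmul_cofactor_grad k j x :
  dotmul (cofactor_field u k x) (grad (u j) x) =
  if k == j then \det (jacobian_mx u x) else 0.
Proof.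
have -> : grad (u j) x = row j (jacobian_mx u x) by rewrite rowK.
rewrite dotmulC -det_replace_row; case: eqP => [<-|/eqP kj].
  by rewrite replace_row_id.
by rewrite det_replace_row_row// eq_sym.
Qed.

(** The average of [dotmul (cofactor_field u k x) (grad (u j) x)], known from
    [dotmul_cofactor_grad], does not change when the gradient is replaced by its
    constant part, by [average_cofactor_grad] for the fluctuation. It follows that
    the matrix of slopes is invertible as soon as the mean Jacobian is not zero. *)
Lemma average_cofactor_slope k j :
  dotmul (average_field (cofactor_field u k)) (slope (u j)) =
  if k == j then average (fun x => \det (jacobian_mx u x)) else 0.
Proof.
pose F := cofactor_field u k.
have cF i : continuous (fun x => F x ord0 i) by exact: continuous_cofactor.
have cD : continuous (fun x => dotmul (F x) (slope (u j))).
  by move=> x; apply: Ck1_continuous; apply: Ck1_sum => i;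
    apply: Ck1M; [exact: Ck1_cofactor|exact: Ck1_cst].
have -> : dotmul (average_field F) (slope (u j)) =
    average (fun x => dotmul (F x) (slope (u j))).
  rewrite /dotmul average_sum => [|i]; last first.
    by apply: Ck1_continuous; apply: Ck1M; [exact: Ck1_cofactor|exact: Ck1_cst].
  apply: eq_bigr => i _; rewrite mxE mulrC -averageZ//.
  by congr average; apply/funext => x; rewrite mulrC.
have Cu := Ck2_Ck1 (u_C2 j); have [du _] := Cu.
have pp := fluctuation_periodic du (u_per j).
have cp : continuous (fun x => dotmul (F x) (grad (fluctuation (u j)) x)).
  apply: Ck1_continuous; apply: Ck1_sum => i; apply: Ck1M; first exact: Ck1_cofactor.
  under eq_fun do rewrite grad_fluctuation// mxE [X in _ + X]mxE.
  by apply: Ck1D; [exact: Ck2_grad|exact: Ck1_cst].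
transitivity (average (fun x => dotmul (F x) (slope (u j))) +
    average (fun x => dotmul (F x) (grad (fluctuation (u j)) x))).
  by rewrite average_cofactor_grad ?addr0//; exact: Ck1_fluctuation.
rewrite -averageD//.
case: ifP => kj; last rewrite -[RHS](@average_cst R d 0).
  all: congr average; apply/funext => x.
  all: rewrite grad_fluctuation// dotmulBr addrC subrK.
  all: by rewrite dotmul_cofactor_grad kj.
Qed.

End cofactor_means.

End mean_values.

(** * Asymptotics of the rectified flow *)

Section flow.
Context {R : realType}.

Lemma cross_cofactor n (xi : 'I_n -> 'rV[R]_n.+1) (A : 'M[R]_n.+1) :
  (forall i, row (lift ord0 i) A = xi i) -> cross xi = \row_j cofactor A ord0 j.
Proof.
move=> Axi; apply/rowP => j; rewrite !mxE cofactor_replace_row; congr (\det _).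
apply/matrixP => p q; rewrite !mxE; case: (unliftP ord0 p) => [i|] -> /=.
  by rewrite -Axi mxE.
by rewrite mxE.
Qed.

(** The cross product of a single vector of the plane is its clockwise rotation,
    so dimension 2 is treated like the others. *)
Lemma stream_vector_cross n (xi : 'I_n.+1 -> 'rV[R]_n.+2) :
  stream_vector xi = cross xi.
Proof.
case: n xi => [|//] xi.
have u1 : unlift ord0 (1 : 'I_2) = Some (ord0 : 'I_1).
  by rewrite (_ : 1 = lift ord0 ord0) ?liftK//; exact: val_inj.
have u0 : unlift ord0 (0 : 'I_2) = None by rewrite unlift_none.
have sum2 (F : 'I_2 -> R) : \sum_i F i = F 0 + F 1.
  rewrite big_ord_recl big_ord1; congr (_ + F _); exact: val_inj.
apply/rowP => j; rewrite !mxE sum2 (_ : \det _ = (j == 0)%:R * xi ord0 ord0 1 -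
    (j == 1)%:R * xi ord0 ord0 0); last first.
  rewrite (expand_det_row _ 0) sum2 /cofactor !det_mx11 !mxE u0 /= !mxE.
  have -> : lift (0 : 'I_2) 0 = 1 by exact: val_inj.
  have -> : lift (1 : 'I_2) 0 = 0 by exact: val_inj.
  rewrite u1 /= expr0 (_ : (-1) ^+ _ = -1 :> R) ?expr1//.
  by rewrite (eq_sym 0) (eq_sym 1) mul1r mulN1r mulrN.
have /orP[/eqP->|/eqP->] : (j == 0) || (j == 1) by case: j => -[|[|]].
  by rewrite !mxE/= !subr0 !mul0r subr0 add0r.
by rewrite !mxE/= !subrr !sub0r !mul0r addr0 sub0r mulN1r mul1r.
Qed.

Lemma first_integral d (b : 'rV[R]_d -> 'rV[R]_d) X (f : 'rV[R]_d -> R) c x t :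
  is_flow b X -> (forall y, differentiable f y) ->
  (forall y, dotmul (b y) (grad f y) = c) -> f (X t x) = f x + t * c.
Proof.
move=> fl df bf; have [X0 dX] := fl x.
pose q s := f (X s x) - s * c.
have dq s : is_derive s (1 : R) q 0.
  have H1 := is_derive_curve (df (X s x)) (dX s).
  have H2 : is_derive s (1 : R) (fun s => s * c) c.
    apply: (is_derive_eq (is_deriveM (is_derive_id s 1) (is_derive_cst c s 1))).
    by rewrite scaler0 add0r /GRing.scale/= mulr1.
  by apply: (is_derive_eq (is_deriveB H1 H2)); rewrite bf subrr.
have := is_derive_0_is_cst t 0 dq; rewrite /q mul0r subr0 X0 => <-.
by rewrite subrK.
Qed.

Section asymptotics.
Variables (n : nat) (b : 'rV[R]_n.+1 -> 'rV[R]_n.+1).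
Variables (v : 'I_n.+1 -> 'rV[R]_n.+1 -> R) (X : R -> 'rV[R]_n.+1 -> 'rV[R]_n.+1).
Hypotheses (v_C2 : forall i, Ck 2 (v i)) (v_per : forall i, Yperiodic (grad (v i))).
Hypothesis det_gt0 : forall x, 0 < \det (jacobian_mx v x).
Hypothesis b_grad : forall i x, dotmul (b x) (grad (v i) x) = (i == ord0)%:R.
Hypothesis X_flow : is_flow b X.

Let s := average (fun x => \det (jacobian_mx v x)).
Let C k := average_field (cofactor_field v k).

Let s_gt0 : 0 < s.
Proof.
apply: average_gt0 => //; apply: Ck1_continuous; apply: Ck1_det => i j.
exact: Ck1_jacobian.
Qed.

(** The matrices of slopes and of mean cofactors are inverse to each other up to
    [s], so a vector is recovered from its products with the slopes. *)
Let slope_coordinates (y : 'rV[R]_n.+1) :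
  s *: y = \sum_i dotmul y (slope (v i)) *: C i.
Proof.
pose Cm := \matrix_i C i; pose S := \matrix_i slope (v i).
have CS : (s^-1 *: Cm) *m S^T = 1%:M.
  apply/matrixP => k j; rewrite -scalemxAl mxE mxE.
  rewrite (eq_bigr (fun l => C k ord0 l * slope (v j) ord0 l)); last first.
    by move=> l _; rewrite !mxE.
  rewrite -/(dotmul _ _) average_cofactor_slope// mxE; case: eqP => _.
    by rewrite mulVf// gt_eqF.
  by rewrite mulr0.
have /mulmx1C SC := CS.
rewrite -[y in LHS]mulmx1 -SC mulmxA -scalemxAr scalerA divff ?gt_eqF// scale1r.
apply/rowP => l; rewrite mxE summxE; apply: eq_bigr => i _.
rewrite [RHS]mxE; congr (_ * _); last by rewrite mxE.
by rewrite mxE; apply: eq_bigr => q _; rewrite !mxE.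
Qed.

(** All that the slopes see of [X t x] is [t] in the first coordinate, up to the
    fluctuations, which are bounded. *)
Let displacement x : exists K : R, forall t, exists2 w : 'rV[R]_n.+1,
  `|w| <= K & s *: X t x = t *: C ord0 + w.
Proof.
have /choice[B HB] : forall i, exists B : R, forall y, `|fluctuation (v i) y| <= B.
  move=> i; have Cv := Ck2_Ck1 (v_C2 i); apply: Yperiodic_bounded.
    by apply: Ck1_continuous; exact: Ck1_fluctuation.
  by apply: fluctuation_periodic => //; case: Cv.
exists (\sum_i (`|v i x| + B i) * `|C i|) => t.
exists (\sum_i (v i x - fluctuation (v i) (X t x)) *: C i).
  apply: le_trans (ler_norm_sum _ _ _) _; apply: ler_sum => i _.
  rewrite normrZ ler_wpM2r// (le_trans (ler_normB _ _))// lerD2l; exact: HB.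
rewrite slope_coordinates.
have E i : dotmul (X t x) (slope (v i)) =
    t * (i == ord0)%:R + (v i x - fluctuation (v i) (X t x)).
  have -> : dotmul (X t x) (slope (v i)) = v i (X t x) - fluctuation (v i) (X t x).
    by rewrite /fluctuation opprB addrC subrK.
  have [dv _] := v_C2 i.
  by rewrite (first_integral x t X_flow dv (b_grad i)); ring.
under eq_bigr do rewrite E scalerDl; rewrite big_split/=; congr (_ + _).
rewrite (bigD1 ord0)//= mulr1 big1 ?addr0// => i i0.
by rewrite (negPf i0) mulr0 scale0r.
Qed.

(** The condition on [F] covers both ends of the time axis. *)
Lemma asymptotic_velocity x (F : set_system R) : Filter F ->
  (forall A : R, \forall t \near F, A < `|t|) ->
  t^-1 *: X t x @[t --> F] --> s^-1 *: C ord0.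
Proof.
move=> FF Foo; have [K HK] := displacement x.
apply/cvgrPdist_lt => e e0.
apply: filterS (Foo (`|K| / (s * e) )) => t tK.
have t0 : t != 0 by rewrite -normr_gt0 (le_lt_trans _ tK)// divr_ge0// ltW// mulr_gt0.
have [w wK E] := HK t.
have -> : t^-1 *: X t x = s^-1 *: C ord0 + (t^-1 * s^-1) *: w.
  have -> : X t x = s^-1 *: (s *: X t x) by rewrite scalerA mulVf ?scale1r ?gt_eqF.
  by rewrite E !scalerDr !scalerA mulrAC mulVf// mul1r.
rewrite opprD addNKr normrN normrZ normrM !normfV (gtr0_norm s_gt0).
rewrite -invfM mulrC ltr_pdivrMr ?mulr_gt0 ?normr_gt0//.
apply: le_lt_trans wK _; apply: le_lt_trans (ler_norm K) _.
by rewrite ltr_pdivrMr ?mulr_gt0// in tK; rewrite mulrC -mulrA.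
Qed.

End asymptotics.
End flow.

(** * Invariant functions from a direction orthogonal to the field *)

Section nonergodicity.
Context {R : realType} {n : nat}.
Variables (b : 'rV[R]_n.+1 -> 'rV[R]_n.+1).
Variables (v : 'I_n.+1 -> 'rV[R]_n.+1 -> R) (X : R -> 'rV[R]_n.+1 -> 'rV[R]_n.+1).
Variable lambda : 'rV[R]_n.+1.
Hypotheses (v_C2 : forall i, Ck 2 (v i)) (v_per : forall i, Yperiodic (grad (v i))).
Hypothesis det_gt0 : forall x, 0 < \det (jacobian_mx v x).
Hypothesis b_cofactor : forall x,
  \det (jacobian_mx v x) *: b x = cofactor_field v ord0 x.
Hypothesis b_lambda : forall x, dotmul (b x) lambda = 0.
Hypothesis X_flow : is_flow b X.

Local Notation e i := (delta_mx ord0 i : 'rV[R]_n.+1).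
Local Notation J := (jacobian_mx v).

(** A linear function is smooth with constant gradient, so [divergence_cofactor]
    applies to [tilt k] as well as to [v]. *)
Definition tilt k : 'I_n.+1 -> 'rV[R]_n.+1 -> R :=
  fun i => if i == k then fun x => dotmul x lambda else v i.

(** By Cramer's rule this is the [k]-th coordinate of [lambda] in the basis of the
    gradients of the [v i]. *)
Definition tilt_ratio k x : R := (\det (J x))^-1 * \det (jacobian_mx (tilt k) x).

Let tilt_C2 k i : Ck 2 (tilt k i).
Proof. by rewrite /tilt; case: ifP => // _; case: (Ck2_linear lambda). Qed.

Lemma jacobian_tilt k x : jacobian_mx (tilt k) x = replace_row (J x) k lambda.
Proof.
apply/row_matrixP => i; rewrite !rowK /tilt; case: ifP => // _.
by case: (Ck2_linear lambda).
Qed.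

Let det_neq0 x : \det (J x) != 0.
Proof. by rewrite gt_eqF. Qed.

(** Orthogonality of [b] and [lambda] says that the coordinate of [lambda] along
    the gradient of [v ord0] vanishes, which makes the two fields parallel. *)
Lemma cofactor_tilt k x : k != ord0 ->
  cofactor_field (tilt k) ord0 x = tilt_ratio k x *: cofactor_field v ord0 x.
Proof.
move=> k0; have l0 : \det (replace_row (J x) ord0 lambda) = 0.
  by rewrite det_replace_row -/(cofactor_field v ord0 x) -b_cofactor dotmulC
    dotmulZl b_lambda mulr0.
apply/rowP => j; rewrite mxE [RHS]mxE mxE /tilt_ratio jacobian_tilt -mulrA.
rewrite -cofactor_replace_other// 1?eq_sym//.
by rewrite mulKf.
Qed.

Let det_C1 (u : 'I_n.+1 -> 'rV[R]_n.+1 -> R) : (forall i, Ck 2 (u i)) ->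
  Ck 1 (fun x => \det (jacobian_mx u x)).
Proof. by move=> Cu; apply: Ck1_det => i j; exact: Ck1_jacobian. Qed.

Let tilt_ratio_diff k x : differentiable (tilt_ratio k) x.
Proof.
have [d1 _] := det_C1 v_C2; have [d2 _] := det_C1 (tilt_C2 k).
by apply: differentiableM => //; exact: differentiableV.
Qed.

(** A divergence-free field whose product with a scalar function is divergence
    free is orthogonal to the gradient of that function; here the field is
    [cofactor_field v ord0], parallel to [b]. *)
Lemma tilt_ratio_transport k x : k != ord0 ->
  dotmul (b x) (grad (tilt_ratio k) x) = 0.
Proof.
move=> k0; pose F := cofactor_field v ord0.
suff FG : dotmul (F x) (grad (tilt_ratio k) x) = 0.
  apply: (mulfI (det_neq0 x)).
  by rewrite mulr0 -dotmulZl b_cofactor.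
have := divergence_cofactor ord0 x (tilt_C2 k).
have dF j : derivable (fun y : 'rV[R]_n.+1 => F y ord0 j) x (e j).
  by apply: Ck1_derivable; exact: Ck1_cofactor.
under eq_bigr => j _.
  rewrite (_ : (fun _ => _) = (fun y => tilt_ratio k y * F y ord0 j)); last first.
    by apply/funext => y; rewrite cofactor_tilt// mxE.
  rewrite deriveM//; last exact: diff_derivable.
  over.
rewrite big_split/= -scaler_sumr divergence_cofactor// scaler0 add0r => <-.
by apply: eq_bigr => j _; rewrite [X in _ * X]mxE.
Qed.

Lemma tilt_ratio_invariant k t x : k != ord0 -> tilt_ratio k (X t x) = tilt_ratio k x.
Proof.
move=> k0; rewrite (@first_integral _ _ b X _ 0)//; first by rewrite mulr0 addr0.
by move=> y; exact: tilt_ratio_transport.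
Qed.

Lemma tilt_ratio_periodic k : Yperiodic (tilt_ratio k).
Proof.
by move=> x m; rewrite /tilt_ratio !jacobian_tilt (jacobian_periodic v_per).
Qed.

Lemma ergodic_tilt_ratio k : ergodic X -> k != ord0 ->
  exists c, forall x, tilt_ratio k x = c.
Proof.
move=> eX k0; have cr : continuous (tilt_ratio k).
  by move=> x; exact: differentiable_continuous.
have [c cE] := eX _ (tilt_ratio_periodic k) (continuous_measurable_row cr)
  (fun t => aeW _ (fun x => tilt_ratio_invariant t x k0)).
by exists c; exact: continuous_ae_cst.
Qed.

(** The coordinates of a nonzero vector do not all vanish, and the first one
    does. *)
Lemma tilt_ratio_neq0 x : lambda != 0 -> exists2 k, k != ord0 & tilt_ratio k x != 0.
Proof.
move=> l0; apply: contrapT => H; move/eqP: l0; apply.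
apply: (det_replace_row_all0 (det_neq0 x)) => k.
have [->|k0] := eqVneq k ord0.
  by rewrite det_replace_row -/(cofactor_field v ord0 x) -b_cofactor dotmulC
    dotmulZl b_lambda mulr0.
apply/eqP/negPn/negP => dk; apply: H; exists k => //.
by rewrite mulf_neq0 ?invr_eq0// jacobian_tilt.
Qed.

Lemma ergodic_tilt : lambda != 0 -> ergodic X ->
  exists k c, k != ord0 /\
    forall x, cofactor_field v ord0 x = c *: cofactor_field (tilt k) ord0 x.
Proof.
move=> l0 eX; have [k k0 rk] := tilt_ratio_neq0 0 l0.
have [c Hc] := ergodic_tilt_ratio eX k0.
have c0 : c != 0 by rewrite -(Hc 0).
exists k, c^-1; split=> // x.
by rewrite cofactor_tilt// Hc scalerA mulVf// scale1r.
Qed.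

End nonergodicity.

(** * The cross product of two vectors *)

Section cross3.
Context {R : realType}.
Implicit Types y z : 'rV[R]_3.

Definition pair_row y z : 'I_2 -> 'rV[R]_3 := fun i => if i == ord0 then y else z.

Let i1 : 'I_3 := lift ord0 ord0.
Let i2 : 'I_3 := lift ord0 (lift ord0 ord0).

Let cross_pairE y z j : cross (pair_row y z) ord0 j =
  \det (replace_row (replace_row (replace_row 0 ord0 (delta_mx ord0 j)) i1 y) i2 z).
Proof.
rewrite mxE; congr (\det _); apply/row_matrixP => i; rewrite !rowK.
case: (unliftP ord0 i) => [k|] -> /=; last by [].
rewrite /pair_row /i1 /i2 !(inj_eq lift_inj).
by case: k => -[|[|//]] kl.
Qed.

Lemma cross_pairC y z : cross (pair_row z y) = - cross (pair_row y z).
Proof. by apply/rowP => j; rewrite [RHS]mxE !cross_pairE det_replace_rowC. Qed.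

Lemma cross_pairZ c y z : cross (pair_row y (c *: z)) = c *: cross (pair_row y z).
Proof.
by apply/rowP => j; rewrite [RHS]mxE !cross_pairE !det_replace_row dotmulZl.
Qed.

End cross3.

(** * The theorem *)

(* The dimension is d = n.+2, and v ord0, v (lift ord0 i) are v_1, v_(i+2). *)
Theorem corollary4p1 (R : realType) (n : nat)
    (b : 'rV[R]_n.+2 -> 'rV[R]_n.+2) (sigma : 'rV[R]_n.+2 -> R)
    (v : 'I_n.+2 -> 'rV[R]_n.+2 -> R)
    (X : R -> 'rV[R]_n.+2 -> 'rV[R]_n.+2)
    (b_periodic : Yperiodic b) (b_C1 : Ck 1 b)
    (sigma_periodic : Yperiodic sigma) (sigma_C0 : Ck 0 sigma)
    (sigma_gt0 : forall x, 0 < sigma x)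
    (v_C2 : forall i, Ck 2 (v i))
    (grad_v_periodic : forall i, Yperiodic (grad (v i)))
    (b_grad_v1 : forall x, unit_cell x -> dotmul (b x) (grad (v ord0) x) = 1)
    (sigma_b : forall x, unit_cell x ->
       sigma x *: b x = stream_vector (fun i => grad (v (lift ord0 i)) x))
    (X_flow : is_flow b X) :
  (exists xi : 'rV[R]_n.+2,
    (forall x, (t^-1 *: X t x) @[t --> +oo] --> xi /\
               (t^-1 *: X t x) @[t --> -oo] --> xi) /\
    xi = (average sigma)^-1 *: average_field (fun x => sigma x *: b x)) /\
  ((exists lambda : 'rV[R]_n.+2,
      [/\ lambda != 0,
          forall x, unit_cell x -> dotmul (b x) lambda = 0 &
          ((n.+2 = 2)%N /\ ~ (exists c, forall x, sigma x *: b x = c)) \/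
          ((n.+2 = 3)%N /\
           ~ (exists w : 'rV[R]_n.+2 -> R,
                [/\ Ck 1 w, Yperiodic (grad w) &
                    forall x, sigma x *: b x =
                      cross (fun i => if i == ord0 then lambda
                                      else grad w x)]))]) ->
   ~ ergodic X).
Proof.
pose J := jacobian_mx v; pose F := cofactor_field v ord0.
have F_stream x : F x = stream_vector (fun i => grad (v (lift ord0 i)) x).
  by rewrite stream_vector_cross; symmetry; apply: cross_cofactor => i; rewrite rowK.
have F_periodic : Yperiodic F by exact: cofactor_field_periodic.
have sigma_bF x : sigma x *: b x = F x.
  apply: (@Yperiodic_eq _ _ _ (fun x => sigma x *: b x)) => //.
    by move=> y k; rewrite sigma_periodic b_periodic.
  by move=> y Yy; rewrite sigma_b// F_stream.
have b_v1 x : dotmul (b x) (grad (v ord0) x) = 1.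
  apply: (@Yperiodic_eq _ _ _ (fun x => dotmul (b x) (grad (v ord0) x)) (fun=> 1)) => //.
  by move=> y k; rewrite b_periodic grad_v_periodic.
have det_sigma x : \det (J x) = sigma x.
  have := dotmul_cofactor_grad v ord0 ord0 x; rewrite eqxx => <-.
  by rewrite -/(F x) -sigma_bF dotmulZl b_v1 mulr1.
have det_gt0 x : 0 < \det (J x) by rewrite det_sigma.
have b_grad i x : dotmul (b x) (grad (v i) x) = (i == ord0)%:R.
  have [->|i0] := eqVneq i ord0; first exact: b_v1.
  apply: (mulfI (lt0r_neq0 (sigma_gt0 x))).
  rewrite mulr0 -dotmulZl sigma_bF dotmul_cofactor_grad.
  by rewrite eq_sym (negPf i0).
split.
  exists ((average sigma)^-1 *: average_field F); split; last first.
    by congr (_ *: average_field _); apply/funext => x; rewrite sigma_bF.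
  have -> : average sigma = average (fun x => \det (J x)).
    by congr average; apply/funext => x; rewrite det_sigma.
  move=> x; split;
    apply: (asymptotic_velocity v_C2 grad_v_periodic det_gt0 b_grad X_flow x) => A.
    apply: filterS (nbhs_pinfty_gt (num_real A)) => t At.
    exact: lt_le_trans At (ler_norm t).
  apply: filterS (nbhs_ninfty_lt (num_real (- A))) => t tA.
  by rewrite -normrN; apply: lt_le_trans _ (ler_norm _); rewrite ltrNr.
move=> [lambda [lambda0 b_lambda nonconst]] eX.
have {}b_lambda x : dotmul (b x) lambda = 0.
  apply: (@Yperiodic_eq _ _ _ (fun x => dotmul (b x) lambda) (fun=> 0)) => //.
  by move=> y k; rewrite b_periodic.
have b_cofactor x : \det (jacobian_mx v x) *: b x = cofactor_field v ord0 x.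
  by rewrite -/(J x) det_sigma sigma_bF.
have [k [c [k0 FE]]] := ergodic_tilt v_C2 grad_v_periodic det_gt0 b_cofactor
  b_lambda X_flow lambda0 eX.
case: (unliftP ord0 k) => [i ki|ki]; last by rewrite ki eqxx in k0.
have tilt_cross x : cofactor_field (tilt v lambda k) ord0 x =
    cross (fun l => if l == i then lambda else grad (v (lift ord0 l)) x).
  symmetry; apply: cross_cofactor => l; rewrite rowK /tilt ki (inj_eq lift_inj).
  by case: ifP => // _; case: (Ck2_linear lambda).
case: nonconst => [[n0 nc]|[n1 nw]].
  case: n0 => n0; subst n; apply: nc.
  exists (c *: cross (fun=> lambda)) => x; rewrite sigma_bF [LHS]FE tilt_cross.
  by congr (_ *: cross _); apply/funext => l; rewrite [l]ord1 [i]ord1.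
case: n1 => n1; subst n; apply: nw.
(* The row [lambda] is the second or the third one; exchanging them costs a sign,
   and [v j] is the function that has not been replaced. *)
have [a [j Fj]] : exists a j, forall x,
    F x = a *: cross (pair_row lambda (grad (v j) x)).
  have [i0|i1] : i = ord0 \/ i = lift ord0 ord0.
  - by case: i {ki tilt_cross} => -[|[|//]] il; [left|right]; exact: val_inj.
  - exists c, (lift ord0 (lift ord0 ord0)) => x; rewrite [LHS]FE tilt_cross i0.
    congr (_ *: cross _); apply/funext => l; rewrite /pair_row.
    by case: (unliftP ord0 l) => [m|] -> //; rewrite [m]ord1.
  - exists (- c), (lift ord0 ord0) => x.
    rewrite [LHS]FE tilt_cross i1 scaleNr -scalerN -cross_pairC.
    congr (_ *: cross _); apply/funext => l; rewrite /pair_row.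
    by case: (unliftP ord0 l) => [m|] -> //; rewrite [m]ord1.
have [dv _] := v_C2 j.
have grad_w x : grad (fun y => a * v j y) x = a *: grad (v j) x.
  by apply/rowP => l; rewrite !mxE -[RHS]/(a *: _) -deriveZ//; exact: diff_derivable.
exists (fun y => a * v j y); split.
- by apply: Ck1M; [exact: Ck1_cst|exact: Ck2_Ck1].
- by move=> x m; rewrite !grad_w grad_v_periodic.
- by move=> x; rewrite sigma_bF Fj grad_w -cross_pairZ.
Qed.
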